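(* Consider a connected linear resistive electrical network whose nodes are split into $N_B\ge 1$ boundary nodes and $N_C\ge 1$ connection nodes, with Laplacian matrix $\mathcal{L}=\mathcal{D}G\mathcal{D}^T$ partitioned accordingly as $\mathcal{L}=\begin{bmatrix}\mathcal{L}_{BB}&\mathcal{L}_{BC}\\ \mathcal{L}_{CB}&\mathcal{L}_{CC}\end{bmatrix}$. Then: (1) The linear map $\mathbb{R}^{N_B}\to\mathbb{R}^{N_C}$, $\psi_B^*\mapsto\psi_C^*:=-\mathcal{L}_{CC}^{-1}\mathcal{L}_{CB}\psi_B^*$, has induced max-norm equal to $1$, i.e. $\sup_{\psi_B^*\neq 0}\|\psi_C^*\|_{\max}/\|\psi_B^*\|_{\max}=1$. (2) Given $\psi_B^*\in\mathbb{R}^{N_B}$, the vector $\psi_C^*=-\mathcal{L}_{CC}^{-1}\mathcal{L}_{CB}\psi_B^*$ is the unique minimizer over $\psi_C\in\mathbb{R}^{N_C}$ of the dissipated power $$\begin{bmatrix}\psi_B^{*T}&\psi_C^T\end{bmatrix}\mathcal{L}\begin{bmatrix}\psi_B^*\\ \psi_C\end{bmatrix}=\sum_{(ij)}g_{(ij)}(\psi_i-\psi_j)^2,$$ where the sum is over all edges $ij$ of the network, $g_{(ij)}$ is the conductance of the edge $ij$, and $\psi=\begin{bmatrix}\psi_B^*\\ \psi_C\end{bmatrix}$. (3) Any other connected linear resistive network with the same set of boundary nodes (and possibly a different, possibly empty, set of connection nodes and different edges and conductances) inducing by Kron reduction the same linear map $J_B=\mathcal{L}_S\psi_B$ has the same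 dissipated power: for every $\psi_B^*\in\mathbb{R}^{N_B}$, the dissipated powers of the two networks, each evaluated at boundary potentials $\psi_B^*$ and the network's own corresponding open-circuit connection-node potentials, are equal.
   Context: A directed graph with $N$ nodes and $M$ edges (multiple edges allowed, no self-loops) is specified by its $N\times M$ incidence matrix $\mathcal{D}$: each column corresponds to an edge and has entry $1$ at the row of the tail node, $-1$ at the row of the head node, and $0$ elsewhere. The graph is connected if any node can be reached from any other node by a sequence of undirected edges. A linear resistive electrical network is such a graph together with a conductance $g_k>0$ for each edge $k=1,\dots,M$. Let $G=\mathrm{diag}(g_1,\dots,g_M)$. The Laplacian matrix is $\mathcal{L}=\mathcal{D}G\mathcal{D}^T$. The vector $\psi\in\mathbb{R}^N$ of nodal voltage potentials and the vector $J\in\mathbb{R}^N$ of nodal currents are related by $J=\mathcal{L}\psi$. The $N=N_B+N_C$ nodes are split into boundary nodes (index $B$) and connection nodes (index $C$), ordered so that boundary nodes come first, and correspondingly $\psi=\begin{bmatrix}\psi_B\\ \psi_C\end{bmatrix}$, $J=\begin{bmatrix}J_B\\ J_C\end{bmatrix}$, and $\mathcal{L}$ is partitioned into blocks. Since the graph is connected and there is at least one boundary node, $\mathcal{L}_{CC}$ is invertible. For prescribed $\psi_B=\psi_B^*$, the open-circuit connection-node potentials are the unique $\psi_C^*$ for which $J_C=0$, namely $\psi_C^*=-\mathcal{L}_{CC}^{-1}\mathcal{L}_{CB}\psi_B^*$. The corresponding boundary currents are $J_B=\mathcal{L}_S\psi_B^*$, where $\mathcal{L}_S:=\mathcal{L}_{BB}-\mathcal{L}_{BC}\mathcal{L}_{CC}^{-1}\mathcal{L}_{CB}$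 is the Schur complement ($\mathcal{L}_S=\mathcal{L}$ if there are no connection nodes). Passing from the network with constraint $J_C=0$ to the map $J_B=\mathcal{L}_S\psi_B$ is called Kron reduction. The dissipated power of a network at potentials $\psi$ is $\psi^T\mathcal{L}\psi=\sum_{(ij)}g_{(ij)}(\psi_i-\psi_j)^2$, with the sum over all edges. The max-norm is $\|\psi\|_{\max}=\max_j|\psi_j|$. *)

(* Defs.v *)
From HB Require Import structures.
From mathcomp Require Import all_boot all_order all_algebra.
From mathcomp Require Import all_classical all_reals.
From mathcomp Require Import topology normedtype.

Set Implicit Arguments.
Unset Strict Implicit.
Unset Printing Implicit Defensive.

Import Order.TTheory GRing.Theory Num.Theory.
Import numFieldNormedType.Exports.

Local Open Scope classical_set_scope.
Local Open Scope ring_scope.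

Record digraph (N : nat) := Digraph {
  edges : nat;
  edge_tail : 'I_edges -> 'I_N;
  edge_head : 'I_edges -> 'I_N;
  no_self_loop : forall k, edge_tail k != edge_head k
}.

Definition incidence (R : pzRingType) (N : nat) (D : digraph N) :
    'M[R]_(N, edges D) :=
  \matrix_(i, k)
    (if i == edge_tail k then 1 else if i == edge_head k then -1 else 0).

Definition adjacent (N : nat) (D : digraph N) : rel 'I_N :=
  fun i j => [exists k : 'I_(edges D),
    (edge_tail k == i) && (edge_head k == j) ||
    (edge_tail k == j) && (edge_head k == i)].

Definition connected_graph (N : nat) (D : digraph N) : Prop :=
  forall i j : 'I_N, connect (adjacent D) i j.

Record network (R : realType) (N : nat) := Network {
  graph :> digraph N;
  conductance : 'I_(edges graph) -> R;
  conductance_gt0 : forall k, 0 < conductance k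
}.

Definition laplacian (R : realType) (N : nat) (W : network R N) : 'M[R]_N :=
  incidence R W *m diag_mx (\row_k conductance k) *m (incidence R W)^T.

Definition dissipated_power (R : realType) (N : nat) (W : network R N)
    (psi : 'cV[R]_N) : R :=
  (psi^T *m laplacian W *m psi) 0 0.

(* In a network on NB + NC nodes, the first NB nodes are the boundary ones. *)
Section BoundaryConnection.
Variables (R : realType) (NB NC : nat) (W : network R (NB + NC)).

Definition L_BB : 'M[R]_(NB, NB) := ulsubmx (laplacian W).
Definition L_BC : 'M[R]_(NB, NC) := ursubmx (laplacian W).
Definition L_CB : 'M[R]_(NC, NB) := dlsubmx (laplacian W).
Definition L_CC : 'M[R]_(NC, NC) := drsubmx (laplacian W).

(* [invmx] is a genuine inverse here: L_CC is invertible as soon as the graph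
   is connected and 0 < NB. *)
Definition open_circuit (psiB : 'cV[R]_NB) : 'cV[R]_NC :=
  - (invmx L_CC *m L_CB *m psiB).

(* For NC = 0 the subtracted product vanishes and L_BB is the Laplacian. *)
Definition schur_complement : 'M[R]_NB := L_BB - L_BC *m invmx L_CC *m L_CB.

Definition kron_map (psiB : 'cV[R]_NB) : 'cV[R]_NB :=
  schur_complement *m psiB.

End BoundaryConnection.

(* The norm of a matrix in the library is its max-norm [mx_norm].  [sup] is 0
   on sets that are empty or unbounded above, so a nonzero value is always a
   genuine least upper bound. *)
Definition induced_max_norm (R : realType) (m n : nat)
    (f : 'cV[R]_m -> 'cV[R]_n) : R :=
  sup [set `|f x| / `|x| | x in [set x | x != 0]].

Definition is_unique_minimizer (R : realType) (T : Type) (f : T -> R) (x : T) :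
    Prop :=
  unique (fun y => forall z, f y <= f z) x.

(* Main.v *)
(** The Laplacian is the Gram matrix of the conductance-weighted edge
differences, so on a connected network the dissipated power vanishes only at
constant potentials.  Hence L_CC is injective, and the power at boundary values
psiB exceeds the power at the open-circuit potential by the power of a potential
vanishing on the boundary: this is (2).  Clipping a potential to the interval
[-m, m], where m is the max-norm of psiB, preserves psiB and does not increase
any edge term, so by uniqueness the minimizer is its own clipping; constants
give equality in (1).  Finally the power at the open-circuit potential is
psiB^T L_S psiB, which gives (3). *)

Require Import Defs.
From HB Require Import structures.
From mathcomp Require Import all_boot all_order all_algebra.
From mathcomp Require Import all_classical all_reals.
From mathcomp Require Import topology normedtype.
From mathcomp Require Import ring lra.

Set Implicit Arguments.
Unset Strict Implicit.
Unset Printing Implicit Defensive.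

Import Order.TTheory GRing.Theory Num.Theory.
Import numFieldNormedType.Exports.

Local Open Scope ring_scope.

(** * Max-norm of column vectors and clipping *)

Lemma max_norm_leP (R : realType) (n : nat) (x : 'cV[R]_n) (c : R) :
  0 <= c -> reflect (forall i, `|x i 0| <= c) (`|x| <= c).
Proof.
move=> c_ge0; rewrite [`|x|]mx_normrE.
apply: (iffP idP) => [xc i | xc].
  by apply: le_trans xc; apply: (le_bigmax _ _ (i, 0)).
(* [0 <= c] also covers the base value 0 of the iterated maximum. *)
by apply/bigmax_leP; split => // -[i j] _; rewrite ord1.
Qed.

Lemma max_norm_const (R : realType) (n : nat) (c : R) :
  (0 < n)%N -> `|const_mx c : 'cV[R]_n| = `|c|.
Proof.
move=> n_gt0; apply/eqP; rewrite eq_le; apply/andP; split.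
  by apply/max_norm_leP => // i; rewrite mxE.
have /max_norm_leP : `|const_mx c : 'cV[R]_n| <= `|const_mx c : 'cV[R]_n| by [].
by move=> /(_ (normr_ge0 _) (Ordinal n_gt0)); rewrite mxE.
Qed.

Definition clip (R : realType) (m x : R) : R :=
  Num.max (- m) (Num.min m x).

Lemma norm_clip_le (R : realType) (m x : R) : 0 <= m -> `|clip m x| <= m.
Proof.
move=> m_ge0; rewrite /clip ler_norml le_max ge_max lexx ge_min lexx /=.
by rewrite andbT; lra.
Qed.

Lemma clip_id (R : realType) (m x : R) : `|x| <= m -> clip m x = x.
Proof.
rewrite ler_norml => /andP[mx xm].
by rewrite /clip (min_idPr xm) (max_idPr mx).
Qed.

(** Each regime comes with linear constraints, in a form that [lra] can use. *)
Lemma clip_cases (R : realType) (m x : R) : 0 <= m ->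
  [\/ clip m x = m /\ m <= x, clip m x = x /\ - m <= x <= m
    | clip m x = - m /\ x <= - m].
Proof.
move=> m_ge0; have [mx|xm] := leP m x.
  apply: Or31; split=> //; rewrite /clip (min_idPl mx).
  by apply/max_idPr; lra.
rewrite /clip (min_idPr (ltW xm)); have [mx|xm'] := leP (- m) x.
  by apply: Or32; split=> //; rewrite ltW.
by apply: Or33; split=> //; exact: ltW.
Qed.

Lemma clip_sqr_dist (R : realType) (m x y : R) :
  0 <= m -> (clip m x - clip m y) ^+ 2 <= (x - y) ^+ 2.
Proof.
(* With [y <= x] both differences are nonnegative, [clip] being monotone, so the squares may be
   compared through their bases. *)
move=> m_ge0; wlog yx : x y / y <= x.
  move=> main; case: (leP y x) => [|/ltW] /main // le_xy.
  by rewrite -sqrrN opprB -[leRHS]sqrrN opprB.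
rewrite lerXn2r ?nnegrE ?subr_ge0 //;
by case: (clip_cases x m_ge0) => -[-> ?]; case: (clip_cases y m_ge0) => -[-> ?]; lra.
Qed.

Lemma incidence_trE (R : realType) (N : nat) (D : digraph N) (psi : 'cV[R]_N) k :
  ((incidence R D)^T *m psi) k 0 =
  psi (edge_tail k) 0 - psi (edge_head k) 0.
Proof.
rewrite mxE (bigD1 (edge_tail k)) //= (bigD1 (edge_head k)) /=; last first.
  by rewrite eq_sym no_self_loop.
rewrite big1 => [|i /andP[/negPf it /negPf ih]]; last first.
  by rewrite !mxE it ih mul0r.
rewrite !mxE !eqxx eq_sym (negPf (no_self_loop k)).
by rewrite mul1r mulN1r addr0.
Qed.

(** * Dissipated power as a quadratic form *)

Section Power.
Variables (R : realType) (N : nat) (W : network R N).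
Implicit Types phi psi : 'cV[R]_N.

Lemma laplacian_sym : (laplacian W)^T = laplacian W.
Proof. by rewrite /laplacian !trmx_mul trmxK tr_diag_mx mulmxA. Qed.

Lemma dissipated_powerE psi :
  dissipated_power W psi =
  \sum_(k < edges W) conductance k
    * (psi (edge_tail k) 0 - psi (edge_head k) 0) ^+ 2.
Proof.
rewrite /dissipated_power /laplacian -!mulmxA mulmxA.
(* Reading [psi^T D] as [(D^T psi)^T] leaves a sum of weighted squares of edge differences. *)
rewrite -{1}[incidence R W]trmxK -trmx_mul mxE; apply: eq_bigr => k _.
by rewrite mul_diag_mx !mxE -!incidence_trE !mxE expr2 mulrCA.
Qed.

Lemma dissipated_power_ge0 psi : 0 <= dissipated_power W psi.
Proof.
rewrite dissipated_powerE sumr_ge0 // => k _.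
by rewrite mulr_ge0 ?sqr_ge0 // ltW // conductance_gt0.
Qed.

Lemma dissipated_power_const c : dissipated_power W (const_mx c) = 0.
Proof.
by rewrite dissipated_powerE big1 // => k _; rewrite !mxE subrr expr0n mulr0.
Qed.

Lemma dissipated_power_eq0 psi : connected_graph W ->
  dissipated_power W psi = 0 -> forall i j, psi i 0 = psi j 0.
Proof.
move=> Wconn; rewrite dissipated_powerE => /psumr_eq0P P0 i j.
have edge_eq (k : 'I_(edges W)) : psi (edge_tail k) 0 = psi (edge_head k) 0.
  apply/eqP; rewrite -subr_eq0 -sqrf_eq0.
  have term_ge0 (l : 'I_(edges W)) : true -> 0 <= conductance l
      * (psi (edge_tail l) 0 - psi (edge_head l) 0) ^+ 2.
    by rewrite mulr_ge0 ?sqr_ge0 // ltW // conductance_gt0.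
  have /eqP := P0 term_ge0 k isT.
  by rewrite mulf_eq0 gt_eqF ?conductance_gt0.
(* The level set of [psi] through [i] is closed under adjacency, hence contains every node reachable
   from [i]. *)
have cl : fingraph.closed (adjacent W) [pred l | psi l 0 == psi i 0].
  move=> a b /existsP[k /orP[] /andP[/eqP <- /eqP <-]];
  by rewrite !inE edge_eq.
by have := closed_connect cl (Wconn i j); rewrite !inE eqxx => /esym/eqP.
Qed.

Lemma dissipated_powerD phi psi :
  dissipated_power W (phi + psi) =
  dissipated_power W phi + (psi^T *m laplacian W *m phi) 0 0 *+ 2
    + dissipated_power W psi.
Proof.
have sym : (phi^T *m laplacian W *m psi) 0 0 = (psi^T *m laplacian W *m phi) 0 0.
  (* The two cross terms are transposes of each other, as the Laplacian is symmetric. *)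
  rewrite -[in RHS]laplacian_sym -[phi in RHS]trmxK -!trmx_mul [RHS]mxE.
  by rewrite mulmxA.
rewrite /dissipated_power [(phi + psi)^T]raddfD /= mulmxDr !mulmxDl.
by rewrite ![(_ + _ : 'M_1) 0 0]mxE sym; ring.
Qed.

End Power.

(** * Open-circuit potentials *)

Section OpenCircuit.
Variables (R : realType) (NB NC : nat) (W : network R (NB + NC)).
Hypotheses (NB_gt0 : (0 < NB)%N) (W_connected : connected_graph W).
Implicit Types (psiB : 'cV[R]_NB) (psiC : 'cV[R]_NC).

(** Zero power forces a constant potential, and its value at any boundary node is 0. *)
Lemma grounded_power_eq0 psiC :
  dissipated_power W (col_mx 0 psiC) = 0 -> psiC = 0.
Proof.
move=> P0; apply/colP => i.
have := dissipated_power_eq0 W_connected P0 (rshift NB i) (lshift NC (Ordinal NB_gt0)).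
by rewrite col_mxEd col_mxEu !mxE.
Qed.

Lemma laplacian_col_mx psiB psiC :
  laplacian W *m col_mx psiB psiC =
  col_mx (L_BB W *m psiB + L_BC W *m psiC) (L_CB W *m psiB + L_CC W *m psiC).
Proof. by rewrite -[laplacian W]submxK mul_block_col. Qed.

(** If [v *m L_CC W = 0], then [v *m L_CC W *m v^T] is the power of the potential equal to 0 on the
    boundary and to [v^T] elsewhere, so [v = 0]. *)
Lemma L_CC_unit : L_CC W \in unitmx.
Proof.
rewrite -row_free_unit; apply: inj_row_free => v vL0.
apply: trmx_inj; rewrite trmx0; apply: grounded_power_eq0.
rewrite /dissipated_power -mulmxA laplacian_col_mx tr_col_mx mul_row_col trmxK.
by rewrite trmx0 mul0mx add0r mulmx0 add0r mulmxA vL0 mul0mx mxE.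
Qed.

Lemma laplacian_open_circuit psiB :
  laplacian W *m col_mx psiB (open_circuit W psiB) = col_mx (kron_map W psiB) 0.
Proof.
rewrite laplacian_col_mx /open_circuit /kron_map /schur_complement; congr col_mx.
  by rewrite mulmxN mulmxBl !mulmxA.
by rewrite mulmxN !mulmxA mulmxV ?L_CC_unit // mul1mx subrr.
Qed.

Lemma dissipated_power_open_circuit psiB :
  dissipated_power W (col_mx psiB (open_circuit W psiB)) =
  (psiB^T *m kron_map W psiB) 0 0.
Proof.
rewrite /dissipated_power -mulmxA laplacian_open_circuit tr_col_mx mul_row_col.
by rewrite mulmx0 addr0.
Qed.

(** The cross term pairs a potential vanishing on the boundary with currents vanishing at the
    connection nodes. *)
Lemma dissipated_power_excess psiB psiC :
  dissipated_power W (col_mx psiB psiC) =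
  dissipated_power W (col_mx psiB (open_circuit W psiB))
    + dissipated_power W (col_mx 0 (psiC - open_circuit W psiB)).
Proof.
have -> : col_mx psiB psiC = col_mx psiB (open_circuit W psiB)
    + col_mx 0 (psiC - open_circuit W psiB).
  by rewrite add_col_mx addr0 addrC subrK.
rewrite dissipated_powerD -mulmxA laplacian_open_circuit tr_col_mx mul_row_col.
by rewrite trmx0 mul0mx mulmx0 addr0 mxE mul0rn addr0.
Qed.

Lemma open_circuit_min psiB psiC :
  dissipated_power W (col_mx psiB (open_circuit W psiB)) <=
  dissipated_power W (col_mx psiB psiC).
Proof. by rewrite [leRHS]dissipated_power_excess lerDl dissipated_power_ge0. Qed.

(** One comparison suffices as hypothesis, which suits explicit competitors such as clipped or
    constant potentials. *)
Lemma open_circuit_min_unique psiB psiC :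
  dissipated_power W (col_mx psiB psiC) <=
  dissipated_power W (col_mx psiB (open_circuit W psiB)) ->
  psiC = open_circuit W psiB.
Proof.
rewrite dissipated_power_excess gerDl => P_le0.
apply/eqP; rewrite -subr_eq0; apply/eqP/grounded_power_eq0/eqP.
by rewrite eq_le P_le0 dissipated_power_ge0.
Qed.

Lemma open_circuit_max_principle psiB : `|open_circuit W psiB| <= `|psiB|.
Proof.
set psiC := open_circuit W psiB; set m := `|psiB|.
have m_ge0 : 0 <= m by exact: normr_ge0.
have <- : map_mx (clip m) psiC = psiC.
  apply: open_circuit_min_unique.
  have -> : col_mx psiB (map_mx (clip m) psiC) =
            map_mx (clip m) (col_mx psiB psiC).
    rewrite map_col_mx; congr col_mx; apply/colP => i; rewrite mxE clip_id //.
    by have /max_norm_leP : `|psiB| <= m by []; apply.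
  have clipE j : map_mx (clip m) (col_mx psiB psiC) j 0 =
      clip m (col_mx psiB psiC j 0) by rewrite [LHS]mxE.
  rewrite !dissipated_powerE; apply: ler_sum => k _.
  by rewrite !clipE ler_wpM2l ?clip_sqr_dist // ltW // conductance_gt0.
by apply/max_norm_leP => // i; rewrite mxE norm_clip_le.
Qed.

Lemma open_circuit_const (c : R) : open_circuit W (const_mx c) = const_mx c.
Proof.
apply/esym/open_circuit_min_unique.
by rewrite col_mx_const dissipated_power_const dissipated_power_ge0.
Qed.

Lemma induced_max_norm_open_circuit :
  (0 < NC)%N -> induced_max_norm (open_circuit W) = 1.
Proof.
move=> NC_gt0; rewrite /induced_max_norm; set S := (X in sup X).
(* The constant potential 1 attains the ratio 1; both node sets are nonempty, so both norms are
   1. *)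
have S1 : S 1.
  exists (const_mx 1); last first.
    by rewrite open_circuit_const !max_norm_const // normr1 divr1.
  by rewrite /= -normr_eq0 max_norm_const // normr1 oner_eq0.
have ubS : ubound S 1.
  move=> _ [x /= x_neq0 <-].
  by rewrite ler_pdivrMr ?normr_gt0 // mul1r open_circuit_max_principle.
apply/eqP; rewrite eq_le ge_sup //=; last by exists 1.
by rewrite ub_le_sup //; exists 1.
Qed.

End OpenCircuit.

Theorem proposition4p3 (R : realType) (NB NC : nat) (W : network R (NB + NC))
    (NB_ge1 : (1 <= NB)%N) (NC_ge1 : (1 <= NC)%N)
    (W_connected : connected_graph W) :
  [/\ induced_max_norm (open_circuit W) = 1,
      (forall psiB : 'cV[R]_NB,
         is_unique_minimizer
           (fun psiC : 'cV[R]_NC => dissipated_power W (col_mx psiB psiC))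
           (open_circuit W psiB)
         /\ (forall psiC : 'cV[R]_NC,
               let psi := col_mx psiB psiC in
               dissipated_power W psi =
                 \sum_(k < edges W) conductance k
                   * (psi (edge_tail k) 0 - psi (edge_head k) 0) ^+ 2))
    & (forall (NC' : nat) (W' : network R (NB + NC')),
         connected_graph W' ->
         kron_map W' =1 kron_map W ->
         forall psiB : 'cV[R]_NB,
           dissipated_power W' (col_mx psiB (open_circuit W' psiB)) =
           dissipated_power W (col_mx psiB (open_circuit W psiB)))].
Proof.
split.
- exact: induced_max_norm_open_circuit.
- move=> psiB; split; last by move=> psiC psi; exact: dissipated_powerE.
  split=> [psiC | psiC psiC_min]; first exact: open_circuit_min.
  by apply/esym/open_circuit_min_unique.
- move=> NC' W' W'_connected same_kron psiB.
  by rewrite !dissipated_power_open_circuit // same_kron.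
Qed.
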